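(* Let $\Omega$, $\mathbb{K}$, $g$ be as in the context, and let $\mathfrak{A},\mathfrak{B}$ be nonempty families of subsets of $\mathbb{K}$, each satisfying $(p)$, $(\diamond)$, $(\omega)$, and jointly satisfying $(s)$. Let $(\varrho_\lambda)_{\lambda>0}$ be a self-similar family of probability densities, with $\varrho_\lambda^{|r\rangle}=h(\lambda,r)\,\varrho_{\nu(\lambda,r)}$ for all $r\in(0,1)$, $\lambda>0$, where $h(\lambda,r)>0$, $\nu(\lambda,r)>0$. Assume that 1. $\varrho_\lambda(0)=\lambda$ for every $\lambda>0$, and the family $(\varrho_\lambda)_{\lambda>0}$ is flat at zero; 2. $\lim_{\lambda\downarrow 0}\nu(\lambda,r)=0$ for every $r\in(0,1)$ (for example, this holds if the family is regular); 3. for all sufficiently small $r\in(0,1)$, the family of games with payoffs $\mathbbm{c}^{|r\rangle}[\varrho_\lambda]$ $(\lambda>0)$ has an asymptotic saddle point; 4. the game family with probability densities $\varrho_\lambda$ $(\lambda>0)$ has an asymptotic saddle point, and there exists a function $V_*:\Omega\to\mathbb{R}$ which is the common limit, as $\lambda\downarrow0$, of $\mathcal{V}^{\flat}[\varrho_\lambda]$ and of $\mathcal{V}^{\sharp}[\varrho_\lambda]$, uniformly in $\omega\in\Omega$. Then the game family with probability densities $\varpi_\mu=\mu 1_{[0,1/\mu]}$ $(\mu>0)$ has an asymptotic saddle point, and the common limit of the values $\mathcal{V}^{\flat}[\varpi_\mu]$ and $\mathcal{V}^{\sharp}[\varpi_\mu]$ as $\mu\downarrow 0$ exists, is uniform in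 $\omega\in\Omega$, and coincides with $V_*$.
   Context: **Dynamics.** $\Omega$ is a set (of states); $\mathbb{K}$ is a set of mappings $\mathbb{R}_{\ge0}\to\Omega$ (feasible processes); $g:\Omega\to[0,1]$ is a running cost such that $t\mapsto g(z(t))$ is Borel-measurable for every $z\in\mathbb{K}$. For $\omega\in\Omega$, $\Gamma(\omega)=\{z\in\mathbb{K}: z(0)=\omega\}$. For $\tau\ge0$ and $z',z''\in\mathbb{K}$ with $z'(\tau)=z''(0)$, the concatenation $z'\diamond_\tau z''$ is the map equal to $z'(t)$ for $t<\tau$ and to $z''(t-\tau)$ for $t\ge\tau$. A set $A\subset\mathbb{K}$ is a playable strategy if $A\cap\Gamma(\omega)\ne\varnothing$ for every $\omega\in\Omega$. For playable strategies $A',A''$, $A'\diamond_\tau A''=\{z'\diamond_\tau z'': z'\in A',\ z''\in A'',\ z'(\tau)=z''(0)\}$. **Axioms** for a family $\mathfrak{A}$ of subsets of $\mathbb{K}$ (and likewise for $\mathfrak{B}$): $(p)$ every element of $\mathfrak{A}$ is a playable strategy; $(\omega)$ for each mapping $\xi:\Omega\to\mathfrak{A}$ there is $A\in\mathfrak{A}$ with $\xi(\omega)\cap\Gamma(\omega)=A\cap\Gamma(\omega)$ for all $\omega\in\Omega$; $(\diamond)$ $A'\diamond_\tau A''\in\mathfrak{A}$ for all $\tau>0$ and $A',A''\in\mathfrak{A}$. Joint axiom: $(s)$ $A\cap B\cap\Gamma(\omega)\neq\varnothing$ for all $A\in\mathfrak{A}$, $B\in\mathfrak{B}$, $\omega\in\Omega$.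 **Values.** For bounded $c:\mathbb{K}\to\mathbb{R}$ and $\omega\in\Omega$, $$\mathbb{V}^{\flat}[c](\omega)=\sup_{A\in\mathfrak{A}}\inf_{z\in A\cap\Gamma(\omega)}c(z),\qquad \mathbb{V}^{\sharp}[c](\omega)=\inf_{B\in\mathfrak{B}}\sup_{z\in B\cap\Gamma(\omega)}c(z).$$ A game family with bounded payoffs $c_\lambda:\mathbb{K}\to\mathbb{R}$ $(\lambda>0)$ has an asymptotic saddle point if $|\mathbb{V}^{\flat}[c_\lambda](\omega)-\mathbb{V}^{\sharp}[c_\lambda](\omega)|\to0$ as $\lambda\downarrow0$, uniformly in $\omega\in\Omega$. **Densities.** For a summable Borel-measurable $\varrho:\mathbb{R}_{\ge0}\to\mathbb{R}_{\ge0}$ put $\mathbbm{c}[\varrho](z)=\int_0^\infty\varrho(t)g(z(t))\,dt$ $(z\in\mathbb{K})$, $\mathcal{V}^{\flat}[\varrho]=\mathbb{V}^{\flat}[\mathbbm{c}[\varrho]]$, $\mathcal{V}^{\sharp}[\varrho]=\mathbb{V}^{\sharp}[\mathbbm{c}[\varrho]]$. A probability density is a Borel-measurable $\varrho:\mathbb{R}_{\ge0}\to\mathbb{R}_{\ge0}$ with $\lim_{T\to\infty}\int_0^T\varrho(t)\,dt=1$. For $r\in(0,1)$ the quantile $q[\varrho](r)$ is the minimal number with $\int_0^{q[\varrho](r)}\varrho(t)\,dt=r$. The game family with densities $\varrho_\lambda$ is the game family with payoffs $\mathbbm{c}[\varrho_\lambda]$. For a density $\varrho$ and $r\in(0,1)$: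 $\varrho^{|r\rangle}(t)=\varrho(t+q[\varrho](r))$ for $t\ge0$, and for $z\in\mathbb{K}$ $$\mathbbm{c}^{|r\rangle}[\varrho](z)=\int_0^{q[\varrho](r)}\varrho(t)g(z(t))\,dt+\mathcal{V}^{\sharp}\big[\varrho^{|r\rangle}\big]\big(z(q[\varrho](r))\big).$$ $\mathrm{Var}_a^b[f]$ is the total variation of $f$ on $[a,b)$ (with $\ln 0=-\infty$; if $\ln\varrho$ takes the value $-\infty$ on the interval, the variation is $+\infty$). A family of densities $(\varrho_\lambda)_{\lambda>0}$ is: flat at zero if $\lim_{r\to0}\lim_{\lambda\downarrow0}\mathrm{Var}_0^{q[\varrho_\lambda](r)}[\ln\varrho_\lambda]=0$; regular if $\limsup_{\lambda\downarrow0}\mathrm{Var}_0^{q[\varrho_\lambda](r)}[\ln\varrho_\lambda]$ is finite for each $r\in(0,1)$; self-similar if for each $r\in(0,1)$, $\lambda>0$ there exist $h(\lambda,r)>0$, $\nu(\lambda,r)>0$ with $\varrho_\lambda^{|r\rangle}=h(\lambda,r)\varrho_{\nu(\lambda,r)}$. *)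

(* Defs.v *)
From HB Require Import structures.
From mathcomp Require Import all_boot all_order all_algebra.
From mathcomp Require Import all_classical all_reals all_analysis.
Import Order.TTheory GRing.Theory Num.Theory.
Import numFieldNormedType.Exports.

Set Implicit Arguments.
Unset Strict Implicit.
Unset Printing Implicit Defensive.

Local Open Scope classical_set_scope.
Local Open Scope ring_scope.

Section dynamics.
Context {R : realType} {Omega : Type}.

(* Processes are maps out of the half-line itself, so that two processes are
   equal iff they agree at all t >= 0. *)
Definition process := {nonneg R} -> Omega.

(* Only used at times t >= 0, where the absolute value is the identity. *)
Definition at_time (z : process) (t : R) : Omega := z `|t|%:nng.

Implicit Types (K A B : set process) (AA BB : set (set process)).

Definition Gamma K (w : Omega) : set process :=
  [set z | K z /\ at_time z 0 = w].

Definition concat (tau : R) (z1 z2 : process) : process :=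
  fun t => if t%:num < tau then z1 t else at_time z2 (t%:num - tau).

Definition concat_set (tau : R) (A1 A2 : set process) : set process :=
  [set z | exists z1 z2, [/\ A1 z1, A2 z2, at_time z1 tau = at_time z2 0
                           & z = concat tau z1 z2]].

Definition playable K A : Prop :=
  A `<=` K /\ forall w, A `&` Gamma K w !=set0.

Definition axiom_p K AA : Prop := forall A, AA A -> playable K A.

Definition axiom_omega K AA : Prop :=
  forall xi : Omega -> set process, (forall w, AA (xi w)) ->
  exists2 A, AA A & forall w, xi w `&` Gamma K w = A `&` Gamma K w.

Definition axiom_concat AA : Prop :=
  forall (tau : R) A1 A2, 0 < tau -> AA A1 -> AA A2 ->
  AA (concat_set tau A1 A2).

Definition axiom_s K AA BB : Prop :=
  forall A B w, AA A -> BB B -> A `&` B `&` Gamma K w !=set0.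

(* sup and inf are the real ones: for bounded c, nonempty AA, BB and playable
   strategies, all the sets involved are nonempty and bounded. *)
Definition lower_value K AA (c : process -> R) (w : Omega) : R :=
  sup [set inf (c @` (A `&` Gamma K w)) | A in AA].

Definition upper_value K BB (c : process -> R) (w : Omega) : R :=
  inf [set sup (c @` (B `&` Gamma K w)) | B in BB].

(* The library topology of uniform convergence needs a choiceType domain. *)
Definition uniform_cvg_at0 (F : R -> Omega -> R) (f : Omega -> R) : Prop :=
  forall eps : R, 0 < eps ->
  \forall l \near 0^'+, forall w, `|F l w - f w| < eps.

Definition asymptotic_saddle_point K AA BB (c : R -> process -> R) : Prop :=
  uniform_cvg_at0
    (fun l w => `|lower_value K AA (c l) w - upper_value K BB (c l) w|)
    (fun=> 0).

End dynamics.

Section densities.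
Context {R : realType}.
Implicit Types (rho : R -> R) (rhos : R -> R -> R) (r : R).

(* Densities are functions on R of which only the values on [0, +oo[ are ever
   used or constrained. *)
Definition probability_density rho : Prop :=
  [/\ measurable_fun (`[0, +oo[ : set R) rho,
      forall t, 0 <= t -> 0 <= rho t
    & (\int[lebesgue_measure]_(t in `[0%R, T]) (rho t)%:E)%E
        @[T --> +oo] --> 1%:E].

Definition is_quantile rho r (q : R) : Prop :=
  [/\ 0 <= q,
      (\int[lebesgue_measure]_(t in `[0%R, q]) (rho t)%:E = r%:E)%E
    & forall q' : R, 0 <= q' ->
        (\int[lebesgue_measure]_(t in `[0%R, q']) (rho t)%:E = r%:E)%E ->
        q <= q'].

(* The default value 0 is never used for a probability density and
   0 < r < 1: the minimum is then attained, by continuity. *)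
Definition quantile rho r : R := xget 0 [set q | is_quantile rho r q].

Definition shift_density rho r : R -> R := fun t => rho (t + quantile rho r).

(* The total variation of f on the half-open interval [a, b[, for a < b. *)
Definition total_variation_co (a b : R) (f : R -> R) : \bar R :=
  ereal_sup [set total_variation a b' f | b' in `[a, b[].

(* The total variation of ln rho on [a, b[ with the convention ln 0 = -oo.
   A special case is needed because ln 0 = 0 in the library. *)
Definition ln_variation (a b : R) rho : \bar R :=
  if `[< exists2 t, t \in `[a, b[ & rho t = 0 >] then +oo%E
  else total_variation_co a b (fun t => ln (rho t)).

Definition initial_variation rho r : \bar R :=
  ln_variation 0 (quantile rho r) rho.

(* L r is the inner limit, which has to exist for all small r > 0. *)
Definition flat_at_zero rhos : Prop :=
  exists L : R -> \bar R,
    (\forall r \near 0^'+,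
       initial_variation (rhos l) r @[l --> 0^'+] --> L r) /\
    L r @[r --> 0^'+] --> 0%E.

Definition regular_family rhos : Prop :=
  forall r, 0 < r < 1 ->
  limf_esup (fun l => initial_variation (rhos l) r) (0^'+ : set_system R)
    \is a fin_num.

Definition uniform_density (mu : R) : R -> R :=
  fun t => mu * \1_(`[0, mu^-1]) t.

End densities.

Section density_games.
Context {R : realType} {Omega : Type}.
Implicit Types (K : set (@process R Omega)) (BB : set (set (@process R Omega))).
Implicit Types (g : Omega -> R) (rho : R -> R).

Definition density_payoff g rho (z : @process R Omega) : R :=
  \int[lebesgue_measure]_(t in `[0, +oo[) (rho t * g (at_time z t)).

Definition truncated_payoff K BB g (r : R) rho (z : @process R Omega) : R :=
  let q := quantile rho r in
  \int[lebesgue_measure]_(t in `[0, q]) (rho t * g (at_time z t)) +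
  upper_value K BB (density_payoff g (shift_density rho r)) (at_time z q).

End density_games.

(* Main.v *)
Require Import Defs.
From mathcomp Require Import all_boot all_order all_algebra.
From mathcomp Require Import all_classical all_reals all_analysis.
From mathcomp Require Import measurable_realfun ring lra.
Import Order.TTheory GRing.Theory Num.Theory.
Import numFieldNormedType.Exports.
Set Implicit Arguments.
Unset Strict Implicit.
Unset Printing Implicit Defensive.
Local Open Scope classical_set_scope.
Local Open Scope ring_scope.

(** Flatness at zero makes [rho l] almost constant, equal to its initial value
l, while it spends a small first portion r of its mass. Hence this initial stage
lasts a time q with l q close to r, and costs nearly what the initial stage of
length q of a game with the uniform density of height l costs. By
self-similarity, and because densities have mass 1, the mass left after the stage
is distributed according to (1 - r) [rho (nu l r)], a game of value close to
(1 - r) V, where V is the limit value. One half of the dynamic programming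
principle holds for each of the two values
([upper_value_dynamic_programming], [lower_value_dynamic_programming]): playing
a near-optimal strategy for the first stage and then a near-optimal one for the
rest bounds the value of the whole game from one side. The saddle point of the
truncated games supplies the other side, so that V is nearly a fixed point of
the one-stage operator of the uniform games ([limit_value_almost_fixed]): for
small l both values of the payoff

  int_0^q l g(z(t)) dt + (1 - l q) V(z(q))

lie within d l q of V, with d as small as desired and l q bounded below.

The uniform game of height m, played for a time q, leaves the uniform game of
height m' = m / (1 - m q), weighted by 1 - m q. Writing U(m) for its upper
value, the almost fixed point property and dynamic programming turn a bound
U(m') <= V + c into U(m) <= V + (1 - m q) c + d m q ([uniform_value_step]). Since
1 - m q = m / m', this says that a bound on (U(m') - V - d) / m' is also a bound
on (U(m) - V - d) / m. Each stage increases m by a factor bounded away from 1, so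
finitely many of them lead above the threshold m0, where U - V <= 2 is enough;
hence U(m) <= V + d + 2 m / m0 for every m ([uniform_value_le_almost_fixed]). The
lower value is treated by the same lemma: changing the signs of g and V and
exchanging the players turns lower values into upper ones. Finally, the lower
value is at most the upper one, because any two strategies of the opponents share
a process from each state.

For the statement about regular families, evaluating the self-similarity
equation at time 0 gives (1 - r) nu(l, r) = [rho l] at its r-quantile, and bounded
variation of the logarithm makes the latter at most a constant times l
([self_similar_parameter_cvg0]). *)

(** * Upper and lower values *)

Section values.
Context {R : realType} {Omega : Type}.
Notation proc := ({nonneg R} -> Omega).
Implicit Types (K A B : set proc) (AA BB : set (set proc)) (c : proc -> R).

Definition bounded_on K c := exists M : R, forall z, K z -> `|c z| <= M.

Lemma bounded_onN K c : bounded_on K c -> bounded_on K (fun z => - c z).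
Proof. by move=> [M cM]; exists M => z Kz; rewrite normrN cM. Qed.

(** Inf is defined from sup by a change of sign, so the same change of sign
exchanges the two values; facts about lower values follow from those about upper
values through this identity. *)
Lemma upper_valueN K AA c (w : Omega) :
  upper_value K AA (fun z => - c z) w = - lower_value K AA c w.
Proof.
rewrite /upper_value /lower_value /inf; congr (- sup _).
rewrite image_comp; congr image; apply/funext => A /=.
by rewrite ?/inf image_comp.
Qed.

Lemma eq_upper_value K BB c c' (w : Omega) : (forall z, K z -> c z = c' z) ->
  upper_value K BB c w = upper_value K BB c' w.
Proof.
move=> cc'; rewrite /upper_value; congr inf; congr image; apply/funext => B.
congr sup; apply/seteqP.
by split=> _ [z [Bz [Kz zw]] <-]; exists z; rewrite ?cc'.
Qed.

Section upper.
Variables (K : set proc) (BB : set (set proc)).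
Hypotheses (BB0 : BB !=set0) (BBp : axiom_p K BB).

Lemma sup_over_strategy_ub c B w z : bounded_on K c -> BB B ->
  (B `&` Gamma K w) z -> c z <= sup (c @` (B `&` Gamma K w)).
Proof.
move=> [M cM] BBB zB; apply: ub_le_sup; last by exists z.
by exists M => _ [y [_ [Ky _]] <-]; rewrite (le_trans (ler_norm _))// cM.
Qed.

(** With [upper_value_approx], this describes the upper value of a bounded payoff
as the best bound that the opponent enforces up to any e, so that estimates can be
made on single processes of a single strategy. *)
Lemma upper_value_le c B w m : bounded_on K c -> BB B ->
  (forall z, B z -> Gamma K w z -> c z <= m) -> upper_value K BB c w <= m.
Proof.
move=> bc BBB cm; apply: (@le_trans _ _ (sup (c @` (B `&` Gamma K w)))).
  apply: ge_inf; last by exists B.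
  have [M cM] := bc; exists (- M) => _ [B' BB' <-].
  have [_ /(_ w) [z zB]] := BBp BB'.
  apply: le_trans (sup_over_strategy_ub bc BB' zB).
  by have [_ [Kz _]] := zB; move: (cM z Kz); rewrite ler_norml => /andP[].
apply: ge_sup; last by move=> _ [z [Bz Gz] <-]; exact: cm.
by have [_ /(_ w) [z zB]] := BBp BBB; exists (c z), z.
Qed.

Lemma upper_value_approx c w e : bounded_on K c -> 0 < e ->
  exists2 B, BB B &
    forall z, B z -> Gamma K w z -> c z <= upper_value K BB c w + e.
Proof.
move=> bc e0.
set S := [set sup (c @` (B `&` Gamma K w)) | B in BB].
have S0 : S !=set0 by have [B BBB] := BB0; exists (sup (c @` (B `&` Gamma K w))), B.
have Slt : inf S < inf S + e by rewrite ltrDl.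
have [_ [B BBB <-] /ltW Bi] := inf_lt S0 Slt.
exists B => // z Bz Gz; apply: le_trans Bi.
exact: sup_over_strategy_ub.
Qed.

Lemma le_upper_value c c' a w : bounded_on K c -> bounded_on K c' ->
  (forall z, K z -> c z <= c' z + a) ->
  upper_value K BB c w <= upper_value K BB c' w + a.
Proof.
move=> bc bc' cc'; apply/ler_addgt0Pr => e e0.
have [B BBB cB] := upper_value_approx w bc' e0.
apply: (@upper_value_le _ B) => // z Bz Gz.
by rewrite (le_trans (cc' z _))//; [case: Gz|rewrite addrAC lerD2r cB].
Qed.

Lemma upper_value_norm_le c M w : (forall z, K z -> `|c z| <= M) ->
  `|upper_value K BB c w| <= M.
Proof.
move=> cM; have bc : bounded_on K c by exists M.
rewrite ler_norml; apply/andP; split.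
  rewrite lb_le_inf//.
    by have [B BBB] := BB0; exists (sup (c @` (B `&` Gamma K w))), B.
  move=> _ [B BBB <-].
  have [_ /(_ w) [z zB]] := BBp BBB.
  apply: le_trans (sup_over_strategy_ub bc BBB zB).
  by have [_ [Kz _]] := zB; move: (cM z Kz); rewrite ler_norml => /andP[].
have [B BBB] := BB0.
apply: (@upper_value_le _ B) => // z _ [Kz _].
by rewrite (le_trans (ler_norm _))// cM.
Qed.

Lemma upper_valueZ a c w : 0 < a -> bounded_on K c ->
  upper_value K BB (fun z => a * c z) w = a * upper_value K BB c w.
Proof.
have H b c1 : 0 < b -> bounded_on K c1 ->
    upper_value K BB (fun z => b * c1 z) w <= b * upper_value K BB c1 w.
  move=> b0 bc1; apply/ler_addgt0Pr => e e0.
  have eb : 0 < e / b by rewrite divr_gt0.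
  have [B BBB cB] := upper_value_approx w bc1 eb.
  apply: (@upper_value_le _ B) => //.
    have [M cM] := bc1; exists (b * M) => z Kz.
    by rewrite normrM gtr0_norm// ler_pM2l// cM.
  move=> z Bz Gz; rewrite (le_trans (ler_wpM2l (ltW b0) (cB z Bz Gz)))//.
  by rewrite mulrDr mulrCA divff ?gt_eqF// mulr1.
move=> a0 bc; apply/eqP; rewrite eq_le H//=.
have bac : bounded_on K (fun z => a * c z).
  have [M cM] := bc; exists (a * M) => z Kz.
  by rewrite normrM gtr0_norm// ler_pM2l// cM.
have ai0 : 0 < a^-1 by rewrite invr_gt0.
rewrite mulrC -ler_pdivlMr// mulrC; apply: le_trans (H _ _ ai0 bac).
rewrite le_eqVlt; apply/orP; left; apply/eqP; congr (upper_value K BB _ w).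
by apply/funext => z; rewrite mulKf// gt_eqF.
Qed.

End upper.

Lemma le_lower_value K AA c c' a w : AA !=set0 -> axiom_p K AA ->
  bounded_on K c -> bounded_on K c' -> (forall z, K z -> c z <= c' z + a) ->
  lower_value K AA c w <= lower_value K AA c' w + a.
Proof.
move=> AA0 pA bc bc' cc'.
have := @le_upper_value K AA AA0 pA (fun z => - c' z) (fun z => - c z) a w
  (bounded_onN bc') (bounded_onN bc).
rewrite !upper_valueN => H; rewrite -lerN2 opprD lerBlDr; apply: H => z Kz.
by rewrite -lerBlDr -opprD lerN2 cc'.
Qed.

Lemma lower_value_norm_le K AA c M w : AA !=set0 -> axiom_p K AA ->
  (forall z, K z -> `|c z| <= M) -> `|lower_value K AA c w| <= M.
Proof.
move=> AA0 pA cM; rewrite -normrN -upper_valueN upper_value_norm_le// => z Kz.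
by rewrite normrN cM.
Qed.

Lemma lower_le_upper K AA BB c w : AA !=set0 -> BB !=set0 ->
  axiom_p K AA -> axiom_p K BB -> axiom_s K AA BB -> bounded_on K c ->
  lower_value K AA c w <= upper_value K BB c w.
Proof.
move=> AA0 BB0 pA pB s bc; apply/ler_addgt0Pr => e e0.
have e20 : 0 < e / 2 by rewrite divr_gt0.
have [B BBB cB] := upper_value_approx BB0 w bc e20.
have [A AAA cA] := upper_value_approx AA0 w (bounded_onN bc) e20.
have [z [[Az Bz] Gz]] := s A B w AAA BBB.
have := cB z Bz Gz; have := cA z Az Gz; rewrite upper_valueN.
move: (lower_value _ _ _ _) (upper_value _ _ _ _) => l u; lra.
Qed.

End values.

(** * Translation of integrals, quantiles *)

Section translation.
Context {R : realType}.
Notation mu := (@lebesgue_measure R).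
Implicit Types (f rho : R -> R) (q : R).

(** Lebesgue measure is determined by its values on half-open intervals, whose
lengths are invariant under translation. *)
Lemma lebesgue_measure_shift q (A : set R) : measurable A ->
  pushforward mu (shift q : _ -> measurableTypeR R) A = mu A.
Proof.
move=> mA.
apply/esym/lebesgue_measure_unique => //; first exact: measurable_funD.
move=> mq _ [[a b]] _ <- /=.
rewrite /pushforward/=.
have -> : shift q @^-1` `]a, b] = `]a - q, b - q]%classic.
  by apply/seteqP; split=> x /=; rewrite !in_itv/= ltrBlDr lerBrDr.
rewrite !lebesgue_measure_itv/= !lte_fin ltrD2r -!EFinB.
by case: ifP => //; rewrite opprB addrA subrK.
Qed.

Section halfline.
Variables (f : R -> R) (q : R).
Hypotheses (q0 : 0 <= q) (intf : mu.-integrable `[0, +oo[ (EFin \o f)).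

Let intfq : mu.-integrable `[q, +oo[ (EFin \o f).
Proof. by apply: integrableS intf => //; apply: subset_itvr; rewrite bnd_simp. Qed.

(* Restricting f to [q, +oo[ and extending by 0 turns the change of variable into
   one over the whole line, where push-forward applies. *)
Let G : R -> \bar R := (EFin \o f) \_ `[q, +oo[.

Let intG : mu.-integrable [set: R] G.
Proof. exact: (integrable_mkcond _ _).1 intfq. Qed.

Let GE : (EFin \o (fun t => f (t + q))) \_ `[0, +oo[ = G \o shift q.
Proof.
apply/funext => t; rewrite /G /= !patchE !mem_setE/= !in_itv/= !andbT.
by rewrite lerDr.
Qed.

Let mshift :
  measurable_fun [set: measurableTypeR R] (shift q : _ -> measurableTypeR R).
Proof. exact: measurable_funD. Qed.

Let mG : measurable_fun [set: R] G.
Proof. exact: measurable_int intG. Qed.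

Let intGq : mu.-integrable [set: R] (G \o shift q).
Proof.
apply/integrableP; split; first exact: measurableT_comp.
have /integrableP[_] := intG; apply: le_lt_trans.
have := @ge0_integral_pushforward _ _ (measurableTypeR R) (measurableTypeR R) R _
  mshift mu [set: R] (fun x => `|G x|%E).
rewrite preimage_setT => <- //; last exact: measurableT_comp.
by rewrite (@eq_measure_integral _ _ _ _ mu)// => A mA _; exact: lebesgue_measure_shift.
Qed.

Lemma integrable_shift : mu.-integrable `[0, +oo[ (EFin \o (fun t => f (t + q))).
Proof. by apply/integrable_mkcond => //; rewrite GE. Qed.

Lemma Rintegral_shift :
  \int[mu]_(t in `[0, +oo[) f (t + q) = \int[mu]_(t in `[q, +oo[) f t.
Proof.
rewrite /Rintegral integral_mkcond GE [in RHS]integral_mkcond -/G; congr fine.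
have := integral_pushforward mshift mG (D := setT) (mu := mu).
rewrite preimage_setT => <- //; apply: eq_measure_integral => A mA _.
exact: lebesgue_measure_shift.
Qed.

Lemma Rintegral_halfline_split : \int[mu]_(t in `[0, +oo[) f t =
  \int[mu]_(t in `[0, q]) f t + \int[mu]_(t in `[0, +oo[) f (t + q).
Proof.
rewrite Rintegral_shift.
have := @Rintegral_itvB _ f (BLeft 0) +oo%O q intf.
rewrite bnd_simp => /(_ q0); rewrite bnd_simp => /(_ isT).
rewrite Rintegral_itv_obnd_cbnd; last first.
  by apply: integrableS intf => //; apply: subset_itvr; rewrite bnd_simp.
move=> <-; ring.
Qed.

End halfline.

End translation.

Section density.
Context {R : realType}.
Notation mu := (@lebesgue_measure R).
Implicit Types (rho : R -> R) (q r : R).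

(** Monotone convergence along the segments [0, n], since the density is only
known through its integrals over segments. *)
Lemma integral_probability_density rho : probability_density rho ->
  (\int[mu]_(t in `[0%R, +oo[) (rho t)%:E = 1)%E.
Proof.
move=> [mrho rho0 rho1].
have sub (i : nat) : `[0%R, i%:R]%classic `<=` (`[0, +oo[ : set R).
  by apply: subset_itvl; rewrite bnd_simp.
have H := @ge0_nondecreasing_set_cvg_integral _ (measurableTypeR R) R
  (fun i => `[0%R, i%:R : R]%classic) (fun t => (rho t)%:E) mu.
have -> : `[0%R, +oo[%classic = \bigcup_i `[0%R, i%:R : R]%classic.
  by rewrite itv_bndy_bigcup_BRight; under eq_bigcupr do rewrite add0r.
apply: cvg_unique (H _ _ _ _) _ => //.
- move=> m n mn; rewrite subsetEset; apply: subset_itvl.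
  by rewrite bnd_simp ler_nat.
- by move=> i; apply/measurable_EFinP; apply: measurable_funS (sub i) mrho.
- by move=> i x /= /sub/=; rewrite in_itv/= andbT lee_fin => /rho0.
- exact: cvg_comp cvgr_idn rho1.
Qed.

Lemma integrable_probability_density rho : probability_density rho ->
  mu.-integrable `[0, +oo[ (EFin \o rho).
Proof.
move=> prho; have [mrho rho0 _] := prho.
apply/integrableP; split; first exact/measurable_EFinP.
under eq_integral => t.
  rewrite inE/= in_itv/= andbT => t0.
  rewrite ger0_norm ?rho0//.
  over.
by rewrite integral_probability_density// ltry.
Qed.

Section quantile.
Variables (rho : R -> R) (prho : probability_density rho).

Let F x := \int[mu]_(t in `[0, x]) rho t.

Let irho x : mu.-integrable `[0, x] (EFin \o rho).
Proof.
apply: integrableS (integrable_probability_density prho) => //.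
by apply: subset_itvl; rewrite bnd_simp.
Qed.

Let FE x : (\int[mu]_(t in `[0%R, x]) (rho t)%:E)%E = (F x)%:E.
Proof. by rewrite fineK//; exact: integrable_fin_num. Qed.

Let F0 : F 0 = 0.
Proof. by rewrite /F set_itv1 Rintegral_set1. Qed.

Let nndF x y : x <= y -> F x <= F y.
Proof.
move=> xy; rewrite -lee_fin -!FE; apply: ge0_subset_integral => //.
- by apply/measurable_EFinP; case/integrableP : (irho y) => /measurable_EFinP.
- by move=> t /=; rewrite in_itv/= lee_fin => /andP[t0 _]; case: prho => _ ->.
- by apply: subset_itvl; rewrite bnd_simp.
Qed.

Let F_IVT x y v : 0 <= x -> x <= y -> F x <= v <= F y ->
  exists2 c, x <= c <= y & F c = v.
Proof.
move=> x0 xy /andP[Fxv vFy].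
have cF : {within `[x, y], continuous F}.
  apply: continuous_subspaceW
    (parameterized_integral_continuous (le_trans x0 xy) (irho y)).
  by apply: subset_itvr; rewrite bnd_simp.
have [|c + Fc] := @IVT _ F x y v xy cF; first by rewrite ge_min Fxv le_max vFy orbT.
by rewrite in_itv/=; exists c.
Qed.

(** The distribution function F is continuous, so it reaches the value r, and the
infimum of the times at which it does so is one of them. *)
Lemma quantileP r : 0 < r < 1 -> is_quantile rho r (quantile rho r).
Proof.
move=> /andP[r0 r1]; rewrite /quantile; case: xgetP => [//|noq].
have [T T0 FT] : exists2 T, 0 <= T & r <= F T.
  have [_ _ rho1] := prho.
  have rlt : (r%:E < 1)%E by rewrite lte_fin.
  have [M [_ HM]] := rho1 _ (open_ereal_gt_ereal rlt).
  have : `|M| + 1 > M by rewrite (le_lt_trans (ler_norm _))// ltrDl.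
  move/HM => /=; rewrite FE lte_fin => /ltW rF.
  by exists (`|M| + 1) => //; rewrite addr_ge0.
have [|x1 /andP[x10 _] Fx1] := @F_IVT 0 T r (lexx _) T0.
  by rewrite F0 (ltW r0).
pose S := [set x | 0 <= x /\ F x = r].
have S0 : S !=set0 by exists x1.
have lbS : lbound S 0 by move=> x [].
have q0 : 0 <= inf S by exact: lb_le_inf.
have qx1 : inf S <= x1 by apply: ge_inf => //; exists 0.
have Fq : F (inf S) = r.
  apply/eqP; rewrite eq_le -{1}Fx1 nndF//= leNgt; apply/negP => Fqr.
  (* A value strictly between F (inf S) and r is reached at some c > inf S,
     and monotonicity makes c a lower bound of S. *)
  have [|c /andP[qc cx1] Fc] := @F_IVT (inf S) x1 ((F (inf S) + r) / 2) q0 qx1.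
    by rewrite Fx1; apply/andP; split; lra.
  have : c <= inf S.
    apply: lb_le_inf => // x [x0 Fx]; rewrite leNgt; apply/negP => /ltW/nndF.
    by rewrite Fx Fc; lra.
  by move/nndF; rewrite Fc; lra.
case: (noq (inf S)); split; rewrite ?FE ?Fq// => q' q'0; rewrite FE => -[Fq'].
by apply: ge_inf => //; exists 0.
Qed.

Lemma quantile_integral r : 0 < r < 1 ->
  \int[mu]_(t in `[0, quantile rho r]) rho t = r.
Proof. by case/quantileP => _; rewrite FE => -[]. Qed.

Lemma quantile_gt0 r : 0 < r < 1 -> 0 < quantile rho r.
Proof.
move=> r01; have [q0 _ _] := quantileP r01.
rewrite lt0r q0 andbT; apply: contraPneq (quantile_integral r01) => ->.
by rewrite -/(F 0) F0 => r0; move: r01; rewrite -r0 ltxx.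
Qed.

Lemma quantile_lt r r' : 0 < r -> r < r' -> r' < 1 ->
  quantile rho r < quantile rho r'.
Proof.
move=> r0 rr' r'1; rewrite ltNge; apply/negP => /nndF; apply/negP.
by rewrite /F !quantile_integral ?r0 ?(lt_trans rr')// ?(lt_trans r0)// -ltNge.
Qed.

Lemma integral_shift_density r : 0 < r < 1 ->
  \int[mu]_(t in `[0, +oo[) shift_density rho r t = 1 - r.
Proof.
move=> r01.
have := Rintegral_halfline_split (ltW (quantile_gt0 r01))
  (integrable_probability_density prho).
rewrite quantile_integral// {1}/Rintegral integral_probability_density//=.
by move=> ->; rewrite addrAC subrr add0r.
Qed.

End quantile.

End density.

(** * Integral payoffs and dynamic programming *)

Lemma uniform_density_integrable (R : realType) (m : R) : 0 < m ->
  lebesgue_measure.-integrable `[0, +oo[ (EFin \o uniform_density m).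
Proof.
move=> m0; apply: (@integrableS _ (measurableTypeR R) R _ setT) => //.
rewrite (_ : _ \o _ = fun t => (m%:E * (\1_(`[0, m^-1]%classic) t)%:E)%E)//.
apply: integrableZl => //; exact: integrable_indic_itv.
Qed.

Lemma uniform_density_integral (R : realType) (m : R) : 0 < m ->
  \int[lebesgue_measure]_(t in `[0, +oo[) `|uniform_density m t| = 1.
Proof.
move=> m0.
have -> : \int[lebesgue_measure]_(t in `[0, +oo[) `|uniform_density m t| =
    \int[lebesgue_measure]_(t in `[0, m^-1]) m.
  rewrite [LHS]Rintegral_mkcond [RHS]Rintegral_mkcond.
  apply: eq_Rintegral => t _; rewrite !patchE !mem_setE /uniform_density indicE.
  rewrite mem_setE !in_itv/= andbT; case: (leP 0 t) => //= t0.
  by case: ifP; rewrite ?mulr1 ?mulr0 ?normr0// gtr0_norm.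
rewrite Rintegral_cst//= lebesgue_measure_itv/= lte_fin invr_gt0 m0/=.
by rewrite subr0 divff// gt_eqF.
Qed.

Lemma integrable_bounded_segment (R : realType) (phi : R -> R) (q M : R) :
  measurable_fun `[0, q] phi -> (forall t, 0 <= t -> `|phi t| <= M) ->
  lebesgue_measure.-integrable `[0, q] (EFin \o phi).
Proof.
move=> mphi phiM; apply: measurable_bounded_integrable => //.
  by rewrite [X in (X < _)%E](_ : _ = lebesgue_measure `[0, q])//
     lebesgue_measure_itv/=; case: ifP => _; rewrite ?ltry// -EFinD ltry.
exists M; split; first exact: num_real.
move=> N MN t /=; rewrite in_itv/= => /andP[t0 _].
by rewrite (le_trans (phiM t t0))// ltW.
Qed.

Section payoff.
Context {R : realType} {Omega : Type}.
Notation mu := (@lebesgue_measure R).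
Notation proc := ({nonneg R} -> Omega).
Variables (K : set proc) (g : Omega -> R).
Hypothesis g1 : forall w, `|g w| <= 1.
Hypothesis gmeas : forall z, K z ->
  measurable_fun (`[0, +oo[ : set R) (fun t : R => g (at_time z t)).
Implicit Types (f : R -> R) (z : proc).

Lemma integrable_payoff f z : mu.-integrable `[0, +oo[ (EFin \o f) -> K z ->
  mu.-integrable `[0, +oo[ (EFin \o (fun t => f t * g (at_time z t))).
Proof.
move=> intf Kz; apply: (le_integrable _ _ _ intf) => //.
  apply/measurable_EFinP; apply: measurable_funM; last exact: gmeas.
  by apply/measurable_EFinP; exact: measurable_int intf.
by move=> t _ /=; rewrite lee_fin normrM ler_piMr.
Qed.

Lemma Rintegral_payoff_le (D : set R) f z : measurable D -> D `<=` `[0, +oo[ ->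
  mu.-integrable `[0, +oo[ (EFin \o f) -> K z ->
  `|\int[mu]_(t in D) (f t * g (at_time z t))| <= \int[mu]_(t in D) `|f t|.
Proof.
move=> mD D0 intf Kz.
have intD : mu.-integrable D (EFin \o (fun t => f t * g (at_time z t))).
  by apply: integrableS (integrable_payoff intf Kz).
apply: le_trans (le_normr_Rintegral _ intD) _ => //.
apply: le_Rintegral => //.
- by rewrite (_ : _ \o _ = abse \o (EFin \o (fun t => f t * g (at_time z t))))//;
     exact: integrable_abse.
- rewrite (_ : _ \o _ = abse \o (EFin \o f))//; apply: integrable_abse.
  by apply: integrableS intf.
- by move=> t _; rewrite normrM ler_piMr.
Qed.

Lemma density_payoff_le f z : mu.-integrable `[0, +oo[ (EFin \o f) -> K z ->
  `|density_payoff g f z| <= \int[mu]_(t in `[0, +oo[) `|f t|.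
Proof. by move=> intf Kz; exact: Rintegral_payoff_le. Qed.

Lemma density_payoff_bounded f : mu.-integrable `[0, +oo[ (EFin \o f) ->
  bounded_on K (density_payoff g f).
Proof.
by move=> intf; exists (\int[mu]_(t in `[0, +oo[) `|f t|) => z;
   exact: density_payoff_le.
Qed.

(** Boundedness of the payoffs of the games stopped at time q with a terminal
reward W, for which the values are then meaningful. *)
Lemma truncation_bounded f (q : R) (W : Omega -> R) (M : R) :
  mu.-integrable `[0, +oo[ (EFin \o f) -> (forall w, `|W w| <= M) ->
  bounded_on K (fun z =>
    \int[mu]_(t in `[0, q]) (f t * g (at_time z t)) + W (at_time z q)).
Proof.
move=> intf WM; exists (\int[mu]_(t in `[0, q]) `|f t| + M) => z Kz.
rewrite (le_trans (ler_normD _ _))// lerD//; apply: Rintegral_payoff_le => //.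
by apply: subset_itvl; rewrite bnd_simp.
Qed.

Lemma at_time_concat_lt z1 z2 q t : 0 <= t < q ->
  at_time (concat q z1 z2) t = at_time z1 t.
Proof. by move=> /andP[t0 tq]; rewrite /at_time /concat ifT//= ger0_norm. Qed.

Lemma at_time_concat_ge z1 z2 q t : 0 <= q -> 0 <= t ->
  at_time (concat q z1 z2) (t + q) = at_time z2 t.
Proof.
move=> q0 t0; rewrite {1}/at_time /concat /=.
by rewrite ifF ger0_norm ?addr_ge0// ?addrK// ltNge lerDr t0.
Qed.

Lemma density_payoff_concat f q z1 z2 : 0 <= q ->
  mu.-integrable `[0, +oo[ (EFin \o f) -> K z1 -> K (concat q z1 z2) ->
  density_payoff g f (concat q z1 z2) =
  \int[mu]_(t in `[0, q]) (f t * g (at_time z1 t)) +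
  density_payoff g (fun t => f (t + q)) z2.
Proof.
move=> q0 intf Kz1 Kz; have I := integrable_payoff intf.
rewrite /density_payoff (Rintegral_halfline_split q0 (I _ Kz)).
have sub : `[0, q[%classic `<=` (`[0, +oo[ : set R).
  by apply: subset_itvl; rewrite bnd_simp.
congr (_ + _).
  rewrite -[LHS]Rintegral_itv_bndo_bndc; last exact: integrableS (I _ Kz).
  rewrite -[RHS]Rintegral_itv_bndo_bndc; last exact: integrableS (I _ Kz1).
  apply: eq_Rintegral => t; rewrite inE/= in_itv/= => t0q.
  by rewrite at_time_concat_lt.
apply: eq_Rintegral => t; rewrite inE/= in_itv/= andbT => t0.
by rewrite at_time_concat_ge.
Qed.

Section dynamic_programming.
Variable BB : set (set proc).
Hypotheses (BB0 : BB !=set0) (BBp : axiom_p K BB).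
Hypotheses (BBc : axiom_concat BB) (BBw : axiom_omega K BB).

(** The opponent may concatenate a strategy near-optimal for the stopped game with
one that is near-optimal for the remaining game from every state at once, which
exists by [axiom_omega]. Strategies that are not concatenations may do better, so
only an inequality holds. *)
Lemma upper_value_dynamic_programming f q w : 0 < q ->
  mu.-integrable `[0, +oo[ (EFin \o f) ->
  upper_value K BB (density_payoff g f) w <=
  upper_value K BB (fun z =>
    \int[mu]_(t in `[0, q]) (f t * g (at_time z t)) +
    upper_value K BB (density_payoff g (fun t => f (t + q))) (at_time z q)) w.
Proof.
move=> q0 intf.
have intfq := integrable_shift (ltW q0) intf.
set W := upper_value K BB (density_payoff g (fun t => f (t + q))).
set D := fun z => _ + W _.
have bD : bounded_on K D.
  apply: truncation_bounded intf _ => u.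
  by apply: upper_value_norm_le => // z; exact: density_payoff_le.
apply/ler_addgt0Pr => e e0.
have e20 : 0 < e / 2 by rewrite divr_gt0.
have [B1 BBB1 B1D] := upper_value_approx BB0 w bD e20.
have /choice[xi xiP] : forall u, exists B, BB B /\ forall z, B z -> Gamma K u z ->
    density_payoff g (fun t => f (t + q)) z <= W u + e / 2.
  move=> u; have [B BBB BW] :=
    upper_value_approx BB0 u (density_payoff_bounded intfq) e20.
  by exists B.
have [B2 BBB2 B2xi] := BBw (fun u => (xiP u).1).
have BBB := BBc q0 BBB1 BBB2.
apply: (upper_value_le BBp (density_payoff_bounded intf) BBB).
move=> z [z1 [z2 [B1z1 B2z2 z12 ->]]] [Kz zw].
have Kz1 : K z1 by have [+ _] := BBp BBB1; exact.
have Kz2 : K z2 by have [+ _] := BBp BBB2; exact.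
rewrite (density_payoff_concat (ltW q0))//.
have z1w : at_time z1 0 = w by rewrite -zw at_time_concat_lt// lexx.
have := B1D z1 B1z1 (conj Kz1 z1w); rewrite /D.
have [xz2 _] : (xi (at_time z1 q) `&` Gamma K (at_time z1 q)) z2.
  by rewrite B2xi.
have := (xiP (at_time z1 q)).2 z2 xz2 (conj Kz2 (esym z12)).
set a := density_payoff _ _ _; set b := W _; set c := Rintegral _ _ _.
set d := upper_value _ _ _ _; lra.
Qed.

End dynamic_programming.
End payoff.

(** * Iterating the initial stage of uniform games *)

(** The uniform densities are self-similar too: a uniform game interrupted at time
q is a uniform game on the remaining time, of mass 1 - m q. *)
Lemma uniform_density_shift (R : realType) (m q t : R) :
  0 < m -> 0 <= q -> m * q < 1 -> 0 <= t ->
  uniform_density m (t + q) =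
  (1 - m * q) * uniform_density (m / (1 - m * q)) t.
Proof.
move=> m0 q0 mq1 t0; have s0 : 0 < 1 - m * q by rewrite subr_gt0.
rewrite /uniform_density mulrA mulrCA divff ?gt_eqF// mulr1; congr (_ * _).
rewrite !indicE !mem_setE !in_itv/= t0 addr_ge0//= invfM invrK.
by rewrite -lerBrDr mulrBr mulr1 mulrA mulVf ?gt_eqF// mul1r.
Qed.

Section iteration.
Context {R : realType} {Omega : Type}.
Notation mu := (@lebesgue_measure R).
Notation proc := ({nonneg R} -> Omega).
Variables (K : set proc) (g : Omega -> R).
Hypothesis g1 : forall w, `|g w| <= 1.
Hypothesis gmeas : forall z, K z ->
  measurable_fun (`[0, +oo[ : set R) (fun t : R => g (at_time z t)).
Variable BB : set (set proc).
Hypotheses (BB0 : BB !=set0) (BBp : axiom_p K BB).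

Lemma upper_value_densityZ (f f' : R -> R) a w : 0 < a ->
  mu.-integrable `[0, +oo[ (EFin \o f') ->
  (forall t, 0 <= t -> f t = a * f' t) ->
  upper_value K BB (density_payoff g f) w =
  a * upper_value K BB (density_payoff g f') w.
Proof.
move=> a0 intf' ff'.
have bf' := density_payoff_bounded g1 gmeas intf'.
rewrite -upper_valueZ//.
have E z : K z -> density_payoff g f z = a * density_payoff g f' z.
  move=> Kz; rewrite /density_payoff -RintegralZl//; last first.
    exact: (integrable_payoff g1 gmeas).
  apply: eq_Rintegral => t; rewrite inE/= in_itv/= andbT => t0.
  by rewrite ff'// mulrA.
exact: eq_upper_value.
Qed.

Variables (Vs : Omega -> R).
Hypothesis Vs1 : forall w, `|Vs w| <= 1.

(** The initial stage of the uniform game of height m, stopped at time q < 1 / m,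
where the unspent mass 1 - m q is paid at the rate Vs. *)
Definition uniform_start_payoff (m q : R) (z : proc) : R :=
  \int[mu]_(t in `[0, q]) (m * g (at_time z t)) +
  (1 - m * q) * Vs (at_time z q).

(** The error is proportional to the mass m q spent in the stage, so that the errors
of successive stages, weighted by the mass left, sum up to at most d. The lower
bound s0 on m q makes finitely many stages enough. *)
Definition upper_almost_fixed : Prop :=
  forall d : R, 0 < d -> exists m0 s0 : R, [/\ 0 < m0, 0 < s0 < 1 &
    forall m, 0 < m < m0 -> exists2 q, s0 <= m * q < 1 &
      forall w, upper_value K BB (uniform_start_payoff m q) w <=
        Vs w + d * (m * q)].

Hypotheses (BBc : axiom_concat BB) (BBw : axiom_omega K BB).

Let U m := upper_value K BB (density_payoff g (uniform_density m)).

(** By dynamic programming, the error c of the remaining game enters with its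
weight 1 - m q, and the error e of the stage is added. *)
Lemma uniform_value_step (m q c e : R) : 0 < m -> 0 < q -> m * q < 1 ->
  (forall w, U (m / (1 - m * q)) w <= Vs w + c) ->
  (forall w, upper_value K BB (uniform_start_payoff m q) w <= Vs w + e) ->
  forall w, U m w <= Vs w + (1 - m * q) * c + e.
Proof.
move=> m0 q0 mq1 Uc Ve w.
have s0 : 0 < 1 - m * q by rewrite subr_gt0.
have intm := uniform_density_integrable m0.
have m'0 : 0 < m / (1 - m * q) by rewrite divr_gt0.
have intm' := uniform_density_integrable m'0.
apply: le_trans (upper_value_dynamic_programming g1 gmeas BB0 BBp BBc BBw
  w q0 intm) _.
rewrite addrAC; apply: le_trans (_ : _ <= upper_value K BB
  (uniform_start_payoff m q) w + (1 - m * q) * c) _; last first.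
  by rewrite lerD2r.
have start z : \int[mu]_(t in `[0, q]) (uniform_density m t * g (at_time z t)) =
    \int[mu]_(t in `[0, q]) (m * g (at_time z t)).
  apply: eq_Rintegral => t; rewrite inE/= in_itv/= => /andP[t0 tq].
  rewrite /uniform_density indicE mem_setE in_itv/= t0/=.
  suff -> : t <= m^-1 by rewrite mulr1.
  by rewrite (le_trans tq)// -[leRHS]mulr1 -ler_pdivrMl ?invr_gt0// invrK ltW.
have UE u : upper_value K BB
    (density_payoff g (fun t => uniform_density m (t + q))) u =
    (1 - m * q) * U (m / (1 - m * q)) u.
  apply: upper_value_densityZ => // t t0.
  by rewrite uniform_density_shift// ltW.
apply: le_upper_value => //.
- have intq := integrable_shift (ltW q0) intm.
  apply: (truncation_bounded g1 gmeas q intm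
    (W := upper_value K BB (density_payoff g _))) => u.
  apply: upper_value_norm_le => // z Kz.
  exact: (density_payoff_le g1 gmeas intq Kz).
- have [|M HM] := truncation_bounded g1 gmeas q intm
    (W := fun u => (1 - m * q) * Vs u) (M := 1 - m * q).
    by move=> u; rewrite normrM gtr0_norm// ler_piMr// ltW.
  by exists M => z Kz; rewrite /uniform_start_payoff -start; exact: HM.
- move=> z Kz; rewrite /uniform_start_payoff start UE -addrA lerD2l -mulrDr.
  by rewrite ler_pM2l.
Qed.

(** With d = e / 2 and m' = m / (1 - m q), the weighted bound
(1 - m q) (d + 2 m' / m0) = d + 2 m / m0 - d m q leaves room for exactly the error
d m q of a stage, so that the bound V + d + 2 m / m0 passes from m' to m; the
induction is on the number of stages that bring m above m0. *)
Lemma uniform_value_le_almost_fixed : upper_almost_fixed ->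
  forall e, 0 < e -> \forall m \near 0^'+, forall w, U m w <= Vs w + e.
Proof.
move=> fixV e e0; have d0 : 0 < e / 2 by rewrite divr_gt0.
have [m0 [s0 [m00 /andP[s00 s01] step]]] := fixV _ d0.
have H n : forall m, 0 < m -> m0 * (1 - s0) ^+ n <= m ->
    forall w, U m w <= Vs w + (e / 2 + 2 * (m / m0)).
  elim: n => [|n IHn] m mgt0 mn w.
    (* Above m0 the trivial bound U - V <= 2 suffices. *)
    have : U m w <= 1.
      rewrite (le_trans (ler_norm _))// upper_value_norm_le// => z Kz.
      rewrite -(uniform_density_integral mgt0).
      exact: (density_payoff_le g1 gmeas (uniform_density_integrable _)).
    have : 1 <= m / m0 by rewrite ler_pdivlMr// mul1r -[m0]mulr1.
    have := Vs1 w; rewrite ler_norml => /andP[+ _].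
    set x := Vs w; set y := U m w; set v := m / m0; lra.
  have [m0m|mm0] := leP m0 m; first by apply: IHn => //; rewrite (le_trans _ m0m)//
    ler_piMr ?(ltW m00)// exprn_ile1// ?subr_ge0 ?gerBl ltW.
  have [|q /andP[s0mq mq1] qV] := step m; first by rewrite mgt0.
  have q0 : 0 < q by rewrite -(pmulr_rgt0 _ mgt0) (lt_le_trans s00).
  have r0 : 0 < 1 - m * q by rewrite subr_gt0.
  have m'n : m0 * (1 - s0) ^+ n <= m / (1 - m * q).
    rewrite ler_pdivlMr//; apply: le_trans mn.
    rewrite exprSr mulrA ler_wpM2l//; last by rewrite lerB.
    by rewrite mulr_ge0 ?(ltW m00)// exprn_ge0// subr_ge0 ltW.
  have m'0 : 0 < m / (1 - m * q) by rewrite divr_gt0.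
  have := uniform_value_step mgt0 q0 mq1 (IHn _ m'0 m'n) qV w.
  move=> /le_trans; apply; rewrite -addrA lerD2l.
  rewrite le_eqVlt; apply/orP; left; apply/eqP; field.
  by rewrite !gt_eqF.
have Hall m : 0 < m -> forall w, U m w <= Vs w + (e / 2 + 2 * (m / m0)).
  move=> mgt0; have : `|1 - s0| < 1 by rewrite ger0_norm ?subr_ge0 ?gtrBl// ltW.
  have mm0 : 0 < m / m0 by rewrite divr_gt0.
  move=> /cvg_expr/cvgrPdist_lt/(_ _ mm0)[n _ /(_ n (leqnn _))/=].
  rewrite sub0r normrN => /(le_lt_trans (ler_norm _))/ltW nm.
  by apply: (H n) => //; rewrite mulrC -ler_pdivlMr.
near=> m => w.
have mgt0 : 0 < m by [].
apply: le_trans (Hall m mgt0 w) _; rewrite lerD2l.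
have : m / m0 <= e / 4.
  rewrite ler_pdivrMr//; near: m; apply: nbhs_right_le; rewrite mulr_gt0//.
  by rewrite divr_gt0.
set x := m / m0; lra.
Unshelve. all: by end_near. Qed.

End iteration.

(** * Exchanging the players, and densities that are flat at zero *)

Section duality.
Context {R : realType} {Omega : Type}.
Notation mu := (@lebesgue_measure R).
Notation proc := ({nonneg R} -> Omega).
Variables (K : set proc) (g : Omega -> R).
Hypothesis g1 : forall w, `|g w| <= 1.
Hypothesis gmeas : forall z, K z ->
  measurable_fun (`[0, +oo[ : set R) (fun t : R => g (at_time z t)).
Implicit Types (f : R -> R) (z : proc).

Let g1N w : `|- g w| <= 1. Proof. by rewrite normrN. Qed.

Let gmeasN z : K z ->
  measurable_fun (`[0, +oo[ : set R) (fun t : R => - g (at_time z t)).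
Proof. by move=> Kz; apply: measurable_funN; exact: gmeas. Qed.

Lemma Rintegral_payoffN (D : set R) f z : measurable D -> D `<=` `[0, +oo[ ->
  mu.-integrable `[0, +oo[ (EFin \o f) -> K z ->
  \int[mu]_(t in D) (f t * - g (at_time z t)) =
  - \int[mu]_(t in D) (f t * g (at_time z t)).
Proof.
move=> mD D0 intf Kz; rewrite -mulN1r -RintegralZl//; last first.
  by apply: integrableS (integrable_payoff g1 gmeas intf Kz).
by apply: eq_Rintegral => t _; rewrite mulrN mulN1r.
Qed.

Lemma lower_value_density AA f w : mu.-integrable `[0, +oo[ (EFin \o f) ->
  lower_value K AA (density_payoff g f) w =
  - upper_value K AA (density_payoff (fun u => - g u) f) w.
Proof.
move=> intf; rewrite -[LHS]opprK -upper_valueN; congr (- _).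
by apply: eq_upper_value => z Kz; rewrite -Rintegral_payoffN.
Qed.

Lemma lower_value_densityZ AA f f' a w : AA !=set0 -> axiom_p K AA -> 0 < a ->
  mu.-integrable `[0, +oo[ (EFin \o f) ->
  mu.-integrable `[0, +oo[ (EFin \o f') ->
  (forall t, 0 <= t -> f t = a * f' t) ->
  lower_value K AA (density_payoff g f) w =
  a * lower_value K AA (density_payoff g f') w.
Proof.
move=> AA0 pA a0 intf intf' ff'; rewrite !lower_value_density//.
by rewrite mulrN (upper_value_densityZ g1N gmeasN AA0 pA w a0 intf' ff').
Qed.

Lemma lower_value_dynamic_programming AA f q w : AA !=set0 -> axiom_p K AA ->
  axiom_concat AA -> axiom_omega K AA -> 0 < q ->
  mu.-integrable `[0, +oo[ (EFin \o f) ->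
  lower_value K AA (fun z =>
    \int[mu]_(t in `[0, q]) (f t * g (at_time z t)) +
    lower_value K AA (density_payoff g (fun t => f (t + q))) (at_time z q)) w <=
  lower_value K AA (density_payoff g f) w.
Proof.
move=> AA0 pA cA wA q0 intf; rewrite [leRHS]lower_value_density//.
rewrite lerNr -upper_valueN.
apply: le_trans (upper_value_dynamic_programming g1N gmeasN AA0 pA cA wA
  w q0 intf) _.
rewrite le_eqVlt; apply/orP; left; apply/eqP; apply: eq_upper_value => z Kz.
rewrite Rintegral_payoffN//; last by apply: subset_itvl; rewrite bnd_simp.
rewrite /= opprD; congr (_ + _); rewrite lower_value_density ?opprK//.
exact: (integrable_shift (ltW q0)).
Qed.

Lemma uniform_start_payoffN Vs (m q : R) z : K z ->
  uniform_start_payoff (fun u => - g u) (fun u => - Vs u) m q z =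
  - uniform_start_payoff g Vs m q z.
Proof.
move=> Kz; rewrite /uniform_start_payoff /= opprD mulrN; congr (_ + _).
have intg : mu.-integrable `[0, q] (EFin \o (fun t => m * g (at_time z t))).
  apply: (integrable_bounded_segment (M := `|m|)) => [|t _].
    apply: measurable_funM => //; apply: measurable_funS (gmeas Kz) => //.
    by apply: subset_itvl; rewrite bnd_simp.
  by rewrite normrM ler_piMr.
rewrite -[RHS]mulN1r -RintegralZl//.
by apply: eq_Rintegral => t _; rewrite mulrN mulN1r.
Qed.

End duality.

Section initial_segment.
Context {R : realType}.
Notation mu := (@lebesgue_measure R).
Implicit Types (rho : R -> R) (r l M : R).

(** Each t in [0, q[ ends a segment [0, t] whose variation bounds the increment of
the logarithm; the convention ln 0 = -oo excludes zeros of the density. *)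
Lemma initial_variation_ln rho r M t : probability_density rho -> 0 < r < 1 ->
  (initial_variation rho r <= M%:E)%E -> 0 <= t < quantile rho r ->
  0 < rho t /\ `|ln (rho t) - ln (rho 0)| <= M.
Proof.
move=> prho r01; rewrite /initial_variation /ln_variation.
case: asboolP => [_|noz]; first by rewrite leye_eq.
move=> vM /andP[t0 tq]; split.
  rewrite lt0r; case: prho => _ -> // _; rewrite andbT; apply/eqP => rt0.
  by apply: noz; exists t => //; rewrite in_itv/= t0.
rewrite -lee_fin; apply: le_trans vM.
apply: le_trans (total_variation_ge (fun t => ln (rho t)) t0) _.
by apply: ereal_sup_ubound; exists t; rewrite //= in_itv/= t0.
Qed.

(** A variation of the logarithm of at most ln (1 + k) confines the density
between l / (1 + k) and l (1 + k). *)
Lemma density_near_start rho r l k t : probability_density rho -> 0 < r < 1 ->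
  0 < k -> 0 < l -> rho 0 = l ->
  (initial_variation rho r <= (ln (1 + k))%:E)%E -> 0 <= t < quantile rho r ->
  `|l - rho t| <= l * k.
Proof.
move=> prho r01 k0 l0 rho0 vk /(initial_variation_ln prho r01 vk)[rt0].
rewrite rho0; have k1 : 0 < 1 + k by rewrite addr_gt0.
rewrite ler_norml => /andP[H1 H2].
have lo : l <= rho t * (1 + k).
  rewrite -ler_ln ?posrE ?mulr_gt0// lnM ?posrE//; lra.
have hi : rho t <= l * (1 + k).
  rewrite -ler_ln ?posrE ?mulr_gt0// lnM ?posrE//; lra.
rewrite ler_norml; apply/andP; split; first lra.
move: (rho t) rt0 lo hi => x x0 lo hi.
have [xl|lx] := leP x l; last by have := mulr_gt0 l0 k0; lra.
have : x * k <= l * k by rewrite ler_pM2r.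
lra.
Qed.

Lemma flat_eventually (rhos : R -> R -> R) d : flat_at_zero rhos -> 0 < d ->
  \forall r \near 0^'+, \forall l \near 0^'+,
    (initial_variation (rhos l) r <= d%:E)%E.
Proof.
move=> [L [cvL L0]] d0.
have d0' : (0 < d%:E)%E by rewrite lte_fin.
have Ld := L0 _ (open_ereal_lt_ereal d0').
near=> r.
have Lrd : (L r < d%:E)%E by near: r; exact: Ld.
have cr : initial_variation (rhos l) r @[l --> 0^'+] --> L r by near: r.
have cd := cr _ (open_ereal_lt_ereal Lrd).
by near=> l; apply: ltW; near: l; exact: cd.
Unshelve. all: by end_near. Qed.

(** Both sides of the self-similarity equation are integrated over the half-line:
the shifted density has mass 1 - r, and [rhos (nu l r)] has mass 1. *)
Lemma self_similar_factor (rhos h nu : R -> R -> R) l r :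
  (forall l, 0 < l -> probability_density (rhos l)) ->
  (forall r l, 0 < r < 1 -> 0 < l ->
       [/\ 0 < h l r, 0 < nu l r
         & forall t, 0 <= t ->
             shift_density (rhos l) r t = h l r * rhos (nu l r) t]) ->
  0 < r < 1 -> 0 < l -> h l r = 1 - r.
Proof.
move=> pd ss r01 l0; have [h0 nu0 E] := ss r l r01 l0.
rewrite -(integral_shift_density (pd l l0) r01).
have pn := pd _ nu0.
under eq_Rintegral => t.
  rewrite inE/= in_itv/= andbT => t0; rewrite E//.
  over.
rewrite RintegralZl//; last exact: integrable_probability_density.
by rewrite /Rintegral integral_probability_density// mulr1.
Qed.

End initial_segment.

(** * Comparison with the initial stage of a uniform game *)

Lemma near_right0P (R : realType) (P : R -> Prop) :
  (\forall x \near 0^'+, P x) <->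
  exists2 e : R, 0 < e & forall x, 0 < x < e -> P x.
Proof.
split=> [[e /= e0 He]|[e e0 He]].
  exists e => // x /andP[x0 xe]; apply: He => //=.
  by rewrite sub0r normrN gtr0_norm.
by near=> x; apply: He; apply/andP; split.
Unshelve. all: by end_near. Qed.

Lemma near_right0_comp (R : realType) (u : R -> R) (P : R -> Prop) :
  u l @[l --> 0^'+] --> (0 : R) -> (forall l, 0 < l -> 0 < u l) ->
  (\forall x \near 0^'+, P x) -> \forall l \near 0^'+, P (u l).
Proof.
move=> u0 upos /near_right0P[e e0 He].
near=> l; apply: He; rewrite upos//=.
have : `|0 - u l| < e by near: l; move/cvgrPdist_lt: u0; exact.
by rewrite sub0r normrN => /(le_lt_trans (ler_norm _)).
Unshelve. all: by end_near. Qed.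

(** At time 0 self-similarity reads (1 - r) nu(l, r) = [rho l] at its r-quantile,
and the bound on the variation of the logarithm compares this with
[rho l] at 0, which is l. *)
Lemma self_similar_parameter_cvg0 (R : realType) (rho h nu : R -> R -> R) :
  (forall l, 0 < l -> probability_density (rho l)) ->
  (forall r l, 0 < r < 1 -> 0 < l ->
     [/\ 0 < h l r, 0 < nu l r
       & forall t, 0 <= t ->
           shift_density (rho l) r t = h l r * rho (nu l r) t]) ->
  (forall l, 0 < l -> rho l 0 = l) -> regular_family rho ->
  forall r, 0 < r < 1 -> nu l r @[l --> 0^'+] --> (0 : R).
Proof.
move=> pd ss rho0 reg r r01; have /andP[r0 r1] := r01.
(* The variation up to the r-quantile ignores the value at the quantile itself;
   a quantile of larger order r' has it in the interior of its interval. *)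
pose r' := (1 + r) / 2.
have rr' : r < r' by rewrite /r'; lra.
have r'01 : 0 < r' < 1 by rewrite /r'; apply/andP; split; lra.
have := reg r' r'01; rewrite fin_numE => /andP[_].
rewrite -ltey limf_esupE => /ereal_inf_lt[_ [A A0 <-] supA].
have [M AM] : exists M : R, forall l, A l ->
    (initial_variation (rho l) r' <= M%:E)%E.
  have ub l : A l -> (initial_variation (rho l) r' <=
      ereal_sup ((fun l => initial_variation (rho l) r') @` A))%E.
    by move=> Al; apply: ereal_sup_ubound; exists l.
  move: (ereal_sup _) supA ub => [s| |]//= _ ub; first by exists s.
  by exists 0 => l Al; rewrite (le_trans (ub l Al))// leNye.
have sub0 : 0 < 1 - r by rewrite subr_gt0.
apply/cvgrPdist_le => e e0; near=> l.
have l0 : 0 < l by [].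
have [h0 nu0 E] := ss r l r01 l0.
have : shift_density (rho l) r 0 = h l r * nu l r by rewrite E// rho0.
rewrite (self_similar_factor pd ss)// /shift_density add0r => nuE.
have Al : A l by near: l.
have [|rq] := initial_variation_ln (t := quantile (rho l) r) (pd l l0) r'01 (AM l Al).
  by rewrite (quantile_lt (pd l l0))// ?ltW ?(quantile_gt0 (pd l l0))//; case/andP: r'01.
rewrite rho0// ler_norml => /andP[_ lnM_].
have rqM : rho l (quantile (rho l) r) <= l * expR M.
  rewrite -ler_ln ?posrE ?mulr_gt0 ?expR_gt0// lnM ?posrE ?expR_gt0// expRK.
  by rewrite -lerBlDl.
rewrite sub0r normrN gtr0_norm// -(ler_pM2l sub0) -nuE (le_trans rqM)//.
rewrite -ler_pdivlMr ?expR_gt0//; near: l; apply: nbhs_right_le.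
by rewrite !mulr_gt0// invr_gt0 expR_gt0.
Unshelve. all: by end_near. Qed.

Section initial_stage.
Context {R : realType} {Omega : Type}.
Notation mu := (@lebesgue_measure R).
Notation proc := ({nonneg R} -> Omega).
Variables (K : set proc) (g Vs : Omega -> R).
Hypothesis g1 : forall w, `|g w| <= 1.
Hypothesis gmeas : forall z, K z ->
  measurable_fun (`[0, +oo[ : set R) (fun t : R => g (at_time z t)).
Hypothesis Vs1 : forall w, `|Vs w| <= 1.

Section one_density.
Variables (rho : R -> R) (l r k : R).
Hypotheses (prho : probability_density rho) (r01 : 0 < r < 1).
Hypotheses (l0 : 0 < l) (k0 : 0 < k) (rho0 : rho 0 = l).
Hypothesis var_k : (initial_variation rho r <= (ln (1 + k))%:E)%E.
Let q := quantile rho r.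

(** The pointwise distance l k between the density and its initial value is
integrated over the stage of length q. *)
Lemma initial_integral_close (phi : R -> R) :
  measurable_fun (`[0, +oo[ : set R) phi -> (forall t, 0 <= t -> `|phi t| <= 1) ->
  `|\int[mu]_(t in `[0, q]) (l * phi t) - \int[mu]_(t in `[0, q]) (rho t * phi t)|
  <= l * q * k.
Proof.
move=> mphi phi1; have q0 : 0 < q := quantile_gt0 prho r01.
have sub0 : `[0, q]%classic `<=` (`[0, +oo[ : set R).
  by apply: subset_itvl; rewrite bnd_simp.
have mphiq : measurable_fun `[0, q] phi by apply: measurable_funS mphi.
have irho : mu.-integrable `[0, q] (EFin \o rho).
  by apply: integrableS (integrable_probability_density prho).
have mrho : measurable_fun `[0, q] rho.
  by apply/measurable_EFinP; exact: measurable_int irho.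
have il : mu.-integrable `[0, q] (EFin \o (fun t => l * phi t)).
  apply: (integrable_bounded_segment (M := l)) => [|t t0].
    exact: measurable_funM.
  by rewrite normrM gtr0_norm// ler_piMr ?phi1// ltW.
have ir : mu.-integrable `[0, q] (EFin \o (fun t => rho t * phi t)).
  apply: (le_integrable _ _ _ irho) => //.
    by apply/measurable_EFinP; exact: measurable_funM.
  move=> t /=; rewrite in_itv/= => /andP[t0 _].
  by rewrite lee_fin normrM ler_piMr// phi1.
have sub1 : `[0, q[%classic `<=` (`[0, q] : set R).
  by apply: subset_itvl; rewrite bnd_simp.
have ilr : mu.-integrable `[0, q] (EFin \o (fun t => l * phi t - rho t * phi t)).
  exact: (integrableB _ il ir).
(* The density is controlled on [0, q[ only, hence the half-open integral. *)
rewrite -RintegralB// -Rintegral_itv_bndo_bndc; last exact: integrableS ilr.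
have ilr' : mu.-integrable `[0, q[ (EFin \o (fun t => l * phi t - rho t * phi t)).
  exact: integrableS ilr.
apply: le_trans (le_normr_Rintegral _ ilr') _ => //.
have -> : l * q * k = \int[mu]_(t in `[0, q[) (l * k).
  rewrite Rintegral_cst//= lebesgue_measure_itv/= lte_fin q0/= subr0; ring.
apply: le_Rintegral => //.
- rewrite (_ : _ \o _ = abse \o (EFin \o (fun t => l * phi t - rho t * phi t)))//.
  exact: integrable_abse.
- apply: integrableS (integrable_bounded_segment (q := q) (M := `|l * k|) _ _) => //.
- move=> t /=; rewrite in_itv/= => /andP[t0 tq].
  rewrite -mulrBl normrM; apply: le_trans (ler_piMr _ (phi1 t t0)) _ => //.
  by apply: (density_near_start prho r01) => //; rewrite t0.
Qed.

(** The case phi = 1 of [initial_integral_close], as [rho] spends mass r by time q. *)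
Lemma initial_mass_close : `|l * q - r| <= l * q * k.
Proof.
have q0 : 0 < q := quantile_gt0 prho r01.
have := @initial_integral_close (cst 1) (measurable_cst _).
have -> : \int[mu]_(t in `[0, q]) (rho t * cst 1 t) = r.
  rewrite -[RHS](quantile_integral prho r01).
  by apply: eq_Rintegral => t _; rewrite mulr1.
have -> : \int[mu]_(t in `[0, q]) (l * cst 1 t) = l * q.
  rewrite -[RHS](_ : \int[mu]_(t in `[0, q]) l = _); last first.
    by rewrite Rintegral_cst//= lebesgue_measure_itv/= lte_fin q0/= subr0.
  by apply: eq_Rintegral => t _; rewrite mulr1.
by apply => t _; rewrite normr1.
Qed.

(** The running costs differ by at most l q k, so do the weights 1 - l q and 1 - r
of the terminal rewards, and e accounts for the rewards themselves. *)
Lemma uniform_start_close (W : Omega -> R) e z :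
  (forall w, `|W w - (1 - r) * Vs w| <= e) -> K z ->
  `|uniform_start_payoff g Vs l q z -
    (\int[mu]_(t in `[0, q]) (rho t * g (at_time z t)) + W (at_time z q))|
  <= 2 * (l * q * k) + e.
Proof.
move=> /(_ (at_time z q)) We Kz; rewrite /uniform_start_payoff.
have := @initial_integral_close _ (gmeas Kz) (fun t _ => g1 _).
have := initial_mass_close; have := Vs1 (at_time z q).
move: We; set V := Vs _; set a := Rintegral _ _ _; set b := Rintegral _ _ _.
set w := W _; set x := l * q; move=> We V1 xr ab.
have : `|(x - r) * V| <= x * k.
  by rewrite normrM (le_trans _ xr)// ler_piMr.
rewrite (_ : a + _ - _ = (a - b) - (x - r) * V - (w - (1 - r) * V)); last ring.
move=> xrV; rewrite (le_trans (ler_normB _ _))// lerD//.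
rewrite (_ : 2 * (x * k) = x * k + x * k); last ring.
by rewrite (le_trans (ler_normB _ _))// lerD.
Qed.

End one_density.
End initial_stage.

(** * The limit value and the uniform games *)

Section limit_value.
Context {R : realType} {Omega : Type}.
Notation mu := (@lebesgue_measure R).
Notation proc := ({nonneg R} -> Omega).
Variables (K : set proc) (g Vs : Omega -> R).
Hypothesis g1 : forall w, `|g w| <= 1.
Hypothesis gmeas : forall z, K z ->
  measurable_fun (`[0, +oo[ : set R) (fun t : R => g (at_time z t)).
Hypothesis Vs1 : forall w, `|Vs w| <= 1.
Variables (AA BB : set (set proc)).
Hypotheses (AA0 : AA !=set0) (AAp : axiom_p K AA) (AAc : axiom_concat AA)
  (AAw : axiom_omega K AA).
Hypotheses (BB0 : BB !=set0) (BBp : axiom_p K BB) (BBc : axiom_concat BB)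
  (BBw : axiom_omega K BB).
Variables (rho h nu : R -> R -> R).
Hypothesis rho_pd : forall l, 0 < l -> probability_density (rho l).
Hypothesis rho_self_similar : forall r l, 0 < r < 1 -> 0 < l ->
  [/\ 0 < h l r, 0 < nu l r
    & forall t, 0 <= t ->
        shift_density (rho l) r t = h l r * rho (nu l r) t].
Hypothesis rho0 : forall l, 0 < l -> rho l 0 = l.

Let shift_densityE r l : 0 < r < 1 -> 0 < l -> forall t, 0 <= t ->
  shift_density (rho l) r t = (1 - r) * rho (nu l r) t.
Proof.
move=> r01 l0 t t0; have [_ _ ->//] := rho_self_similar r01 l0.
by rewrite (self_similar_factor rho_pd rho_self_similar).
Qed.

Section one_stage.
Variables (l r k e : R).
Hypotheses (l0 : 0 < l) (r01 : 0 < r < 1) (k0 : 0 < k).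
Hypothesis var_k : (initial_variation (rho l) r <= (ln (1 + k))%:E)%E.
Let q := quantile (rho l) r.
Let T := truncated_payoff K BB g r (rho l).
Hypothesis saddle : forall w, `|lower_value K AA T w - upper_value K BB T w| <= e.
Let lower m := lower_value K AA (density_payoff g (rho m)).
Let upper m := upper_value K BB (density_payoff g (rho m)).
Hypotheses (lower_l : forall w, `|lower l w - Vs w| <= e)
  (upper_l : forall w, `|upper l w - Vs w| <= e)
  (lower_nu : forall w, `|lower (nu l r) w - Vs w| <= e)
  (upper_nu : forall w, `|upper (nu l r) w - Vs w| <= e).

(** Dynamic programming bounds the upper value of the truncated game from below by
that of [rho l], and its lower value from above, up to the gap between the two
values of the remaining game; the saddle point, by which the two values of the
truncated game agree up to e, transfers both bounds to both values. *)
Lemma one_stage_values w :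
  upper_value K BB (uniform_start_payoff g Vs l q) w <=
    Vs w + (2 * (l * q * k) + 5 * e) /\
  Vs w - (2 * (l * q * k) + 3 * e) <=
    lower_value K AA (uniform_start_payoff g Vs l q) w.
Proof.
have pl := rho_pd l0; have [_ nu0 _] := rho_self_similar r01 l0.
have irho := integrable_probability_density pl.
have inu := integrable_probability_density (rho_pd nu0).
have q0 : 0 < q := quantile_gt0 pl r01.
have ish := integrable_shift (ltW q0) irho.
have /andP[r0 r1] := r01; have r10 : 0 < 1 - r by rewrite subr_gt0.
have scaled (x : R) v : `|x - v| <= e -> `|(1 - r) * x - (1 - r) * v| <= e.
  move=> xv; rewrite -mulrBr normrM gtr0_norm// (le_trans _ xv)//.
  by rewrite ler_piMl// gerBl ltW.
pose Wu := upper_value K BB (density_payoff g (shift_density (rho l) r)).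
pose Wl := lower_value K AA (density_payoff g (shift_density (rho l) r)).
have WuV u : `|Wu u - (1 - r) * Vs u| <= e.
  rewrite /Wu (upper_value_densityZ g1 gmeas BB0 BBp u r10 inu); last first.
    exact: shift_densityE.
  exact/scaled/upper_nu.
have WlV u : `|Wl u - (1 - r) * Vs u| <= e.
  rewrite /Wl (lower_value_densityZ g1 gmeas u AA0 AAp r10 _ inu)//; last first.
    exact: shift_densityE.
  exact/scaled/lower_nu.
pose Tl z := \int[mu]_(t in `[0, q]) (rho l t * g (at_time z t)) + Wl (at_time z q).
have W_bounded W : (forall u, `|W u - (1 - r) * Vs u| <= e) ->
    forall u, `|W u| <= e + 1.
  move=> WV u; rewrite -[W u](subrK ((1 - r) * Vs u)).
  rewrite (le_trans (ler_normD _ _))// lerD// normrM gtr0_norm//.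
  by rewrite mulr_ile1 ?(ltW r10)// gerBl ltW.
have bT : bounded_on K T := truncation_bounded g1 gmeas q irho (W_bounded _ WuV).
have bTl : bounded_on K Tl := truncation_bounded g1 gmeas q irho (W_bounded _ WlV).
have close z : K z -> `|uniform_start_payoff g Vs l q z - T z| <=
    2 * (l * q * k) + e.
  exact: (uniform_start_close g1 gmeas Vs1 pl r01 l0 k0 (rho0 l0) var_k).
have bS : bounded_on K (uniform_start_payoff g Vs l q).
  have [M TM] := bT; exists ((2 * (l * q * k) + e) + M) => z Kz.
  by rewrite -[X in `|X|](subrK (T z)) (le_trans (ler_normD _ _))// lerD ?close ?TM.
have dpu : upper l w <= upper_value K BB T w.
  exact: (upper_value_dynamic_programming g1 gmeas BB0 BBp BBc BBw w q0 irho).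
have dpl : lower_value K AA Tl w <= lower l w.
  exact: (lower_value_dynamic_programming g1 gmeas w AA0 AAp AAc AAw q0 irho).
have TTl : lower_value K AA T w <= lower_value K AA Tl w + 2 * e.
  apply: le_lower_value => // z _; rewrite /T /truncated_payoff -/q -/Wu /Tl.
  have := WuV (at_time z q); have := WlV (at_time z q).
  rewrite !ler_norml => /andP[H1 _] /andP[_ H2].
  by rewrite -addrA lerD2l; lra.
have SuT : upper_value K BB (uniform_start_payoff g Vs l q) w <=
    upper_value K BB T w + (2 * (l * q * k) + e).
  apply: le_upper_value => // z /close; rewrite ler_norml => /andP[_].
  by rewrite lerBlDl.
have TSl : lower_value K AA T w <=
    lower_value K AA (uniform_start_payoff g Vs l q) w + (2 * (l * q * k) + e).
  apply: le_lower_value => // z /close; rewrite ler_norml => /andP[+ _].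
  by rewrite lerBrDl lerBlDr.
have := saddle w; have := lower_l w; have := upper_l w.
rewrite !ler_norml => /andP[U1 U2] /andP[L1 L2] /andP[S1 S2].
move: U1 U2 L1 L2 S1 S2 dpu dpl TTl SuT TSl.
move: (upper_value K BB (uniform_start_payoff _ _ _ _) w).
move: (lower_value K AA (uniform_start_payoff _ _ _ _) w).
move: (upper_value K BB T w) (lower_value K AA T w) (lower_value K AA Tl w).
move: (upper l w) (lower l w) (Vs w) (l * q * k) => u v V x a b c d f.
move=> *; split; lra.
Qed.

End one_stage.

Hypothesis rho_flat : flat_at_zero rho.
Hypothesis nu0 : forall r, 0 < r < 1 -> nu l r @[l --> 0^'+] --> (0 : R).
Hypothesis saddle : \forall r \near 0^'+, asymptotic_saddle_point K AA BB
  (fun l => truncated_payoff K BB g r (rho l)).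
Hypothesis lower_cvg : uniform_cvg_at0
  (fun l => lower_value K AA (density_payoff g (rho l))) Vs.
Hypothesis upper_cvg : uniform_cvg_at0
  (fun l => upper_value K BB (density_payoff g (rho l))) Vs.

(** The mass r of the stage is chosen first, so that the density is flat on it, and
then l small enough for the values to be within e of their limits. The errors e
must be small compared with l q, which is at least r / 2: this fixes e. *)
Lemma limit_value_almost_fixed d : 0 < d ->
  exists m0 s0 : R, [/\ 0 < m0, 0 < s0 < 1 &
    forall m, 0 < m < m0 -> exists2 q, s0 <= m * q < 1 & forall w,
      upper_value K BB (uniform_start_payoff g Vs m q) w <= Vs w + d * (m * q) /\
      Vs w - d * (m * q) <= lower_value K AA (uniform_start_payoff g Vs m q) w].
Proof.
move=> d0; pose k := Num.min (1 / 2) (d / 4).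
have k0 : 0 < k by rewrite lt_min; apply/andP; split; lra.
have k2 : k <= 1 / 2 by rewrite ge_min lexx.
have kd : k <= d / 4 by rewrite ge_min lexx orbT.
have lnk0 : 0 < ln (1 + k) by rewrite ln_gt0// ltrDl.
(* k <= 1 / 2 keeps l q between r / 2 and 2 r < 1. *)
near (0 : R)^'+ => r.
have r0 : 0 < r by [].
have r4 : r < 1 / 4 by near: r; apply: nbhs_right_lt; lra.
have r01 : 0 < r < 1 by apply/andP; split; lra.
have sr : asymptotic_saddle_point K AA BB
  (fun l => truncated_payoff K BB g r (rho l)) by near: r.
have vr : \forall l \near 0^'+,
    (initial_variation (rho l) r <= (ln (1 + k))%:E)%E.
  by near: r; exact: flat_eventually.
pose e := d * r / 20.
have e0 : 0 < e by rewrite /e; have := mulr_gt0 d0 r0; lra.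
have nupos l : 0 < l -> 0 < nu l r by move=> /(rho_self_similar r01)[].
have lower_nu := near_right0_comp (nu0 r01) nupos (lower_cvg e0).
have upper_nu := near_right0_comp (nu0 r01) nupos (upper_cvg e0).
have /near_right0P[m0 m00 Hm0] : \forall l \near 0^'+, exists2 q, r / 2 <= l * q < 1 &
    forall w,
      upper_value K BB (uniform_start_payoff g Vs l q) w <= Vs w + d * (l * q) /\
      Vs w - d * (l * q) <= lower_value K AA (uniform_start_payoff g Vs l q) w.
  near=> l; have l0 : 0 < l by [].
  have vl : (initial_variation (rho l) r <= (ln (1 + k))%:E)%E by near: l.
  pose q := quantile (rho l) r.
  have q0 : 0 < q := quantile_gt0 (rho_pd l0) r01.
  have lq0 : 0 < l * q by rewrite mulr_gt0.
  have := initial_mass_close (rho_pd l0) r01 l0 k0 (rho0 l0) vl.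
  rewrite -/q ler_norml => /andP[lq1 lq2].
  have lqk : l * q * k <= l * q * (1 / 2) by rewrite ler_pM2l.
  have lqd : l * q * k <= l * q * (d / 4) by rewrite ler_pM2l.
  exists q; first by apply/andP; split; lra.
  move=> w.
  have [] := @one_stage_values l r k e l0 r01 k0 vl _ _ _ _ _ w.
  - move=> u; have : forall w,
        `| `|lower_value K AA (truncated_payoff K BB g r (rho l)) w -
             upper_value K BB (truncated_payoff K BB g r (rho l)) w| - 0| < e.
      by near: l; exact: sr.
    by move=> /(_ u); rewrite subr0 normr_id => /ltW.
  - move=> u; apply: ltW; move: u; near: l; exact: lower_cvg.
  - move=> u; apply: ltW; move: u; near: l; exact: upper_cvg.
  - move=> u; apply: ltW; move: u; near: l; exact: lower_nu.
  - move=> u; apply: ltW; move: u; near: l; exact: upper_nu.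
  rewrite -/q.
  (* 5 e = d r / 4 <= d (l q) / 2, and 2 (l q) k <= d (l q) / 2. *)
  have dr : d * r <= d * (2 * (l * q)) by rewrite ler_pM2l//; lra.
  have e5 : 2 * (l * q * k) + 5 * e <= d * (l * q) by rewrite /e; lra.
  move=> H1 H2; split.
    by rewrite (le_trans H1)// lerD2l.
  by rewrite (le_trans _ H2)// lerD2l lerN2 (le_trans _ e5)// lerD2l; lra.
exists m0, (r / 2); split => //.
by apply/andP; split; lra.
Unshelve. all: by end_near. Qed.

Lemma uniform_density_values_cvg e : 0 < e -> \forall m \near 0^'+, forall w,
  upper_value K BB (density_payoff g (uniform_density m)) w <= Vs w + e /\
  Vs w - e <= lower_value K AA (density_payoff g (uniform_density m)) w.
Proof.
move=> e0.
have ub : upper_almost_fixed K g BB Vs.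
  move=> d /limit_value_almost_fixed[m0 [s0 [m00 s01 H]]].
  exists m0, s0; split => // m /H[q mq Hq]; exists q => // w.
  by have [] := Hq w.
have lb : upper_almost_fixed K (fun u => - g u) AA (fun u => - Vs u).
  move=> d /limit_value_almost_fixed[m0 [s0 [m00 s01 H]]].
  exists m0, s0; split => // m /H[q mq Hq]; exists q => // w.
  rewrite (@eq_upper_value _ _ _ _ _ (fun z => - uniform_start_payoff g Vs m q z)).
    by rewrite upper_valueN lerNl opprD opprK; have [] := Hq w.
  exact: uniform_start_payoffN.
have g1N w : `|- g w| <= 1 by rewrite normrN.
have Vs1N w : `|- Vs w| <= 1 by rewrite normrN.
have gmeasN z : K z ->
    measurable_fun (`[0, +oo[ : set R) (fun t : R => - g (at_time z t)).
  by move=> Kz; apply: measurable_funN; exact: gmeas.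
have U := uniform_value_le_almost_fixed g1 gmeas BB0 BBp Vs1 BBc BBw ub e0.
have L := uniform_value_le_almost_fixed g1N gmeasN AA0 AAp Vs1N AAc AAw lb e0.
near=> m => w; have m0 : 0 < m by [].
split; first by move: w; near: m.
rewrite (lower_value_density g1 gmeas)//; last exact: uniform_density_integrable.
by rewrite lerNr opprB addrC; move: w; near: m.
Unshelve. all: by end_near. Qed.

End limit_value.

Theorem theorem1 (R : realType) (Omega : Type)
    (K : set ({nonneg R} -> Omega)) (g : Omega -> R)
    (AA BB : set (set ({nonneg R} -> Omega)))
    (rho : R -> R -> R) (h nu : R -> R -> R) (Vstar : Omega -> R)
    (g01 : forall w, 0 <= g w <= 1)
    (gmeas : forall z, K z ->
       measurable_fun (`[0, +oo[ : set R) (fun t : R => g (at_time z t)))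
    (AA0 : AA !=set0) (BB0 : BB !=set0)
    (AAp : axiom_p K AA) (AAc : axiom_concat AA) (AAw : axiom_omega K AA)
    (BBp : axiom_p K BB) (BBc : axiom_concat BB) (BBw : axiom_omega K BB)
    (ABs : axiom_s K AA BB)
    (rho_pd : forall l, 0 < l -> probability_density (rho l))
    (rho_self_similar : forall r l, 0 < r < 1 -> 0 < l ->
       [/\ 0 < h l r, 0 < nu l r
         & forall t, 0 <= t ->
             shift_density (rho l) r t = h l r * rho (nu l r) t])
    (rho0 : forall l, 0 < l -> rho l 0 = l)
    (rho_flat : flat_at_zero rho) :
  (regular_family rho ->
     forall r, 0 < r < 1 -> nu l r @[l --> 0^'+] --> (0 : R)) /\
  ((forall r, 0 < r < 1 -> nu l r @[l --> 0^'+] --> (0 : R)) ->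
   (\forall r \near 0^'+,
      asymptotic_saddle_point K AA BB
        (fun l => truncated_payoff K BB g r (rho l))) ->
   asymptotic_saddle_point K AA BB (fun l => density_payoff g (rho l)) ->
   uniform_cvg_at0
     (fun l => lower_value K AA (density_payoff g (rho l))) Vstar ->
   uniform_cvg_at0
     (fun l => upper_value K BB (density_payoff g (rho l))) Vstar ->
   [/\ asymptotic_saddle_point K AA BB
         (fun mu => density_payoff g (uniform_density mu)),
       uniform_cvg_at0
         (fun mu => lower_value K AA (density_payoff g (uniform_density mu)))
         Vstar
     & uniform_cvg_at0
         (fun mu => upper_value K BB (density_payoff g (uniform_density mu)))
         Vstar]).
Proof.
split; first by move=> reg; exact: (self_similar_parameter_cvg0 rho_pd rho_self_similar rho0 reg).
move=> nu0 saddle _ lower_cvg upper_cvg.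
have g1 w : `|g w| <= 1 by have /andP[gw0 gw1] := g01 w; rewrite ger0_norm.
have Vs1 w : `|Vstar w| <= 1.
  apply/ler_addgt0Pr => e e0; near (0 : R)^'+ => l.
  have l0 : 0 < l by [].
  have Vl : forall w,
      `|lower_value K AA (density_payoff g (rho l)) w - Vstar w| < e.
    by near: l; exact: lower_cvg.
  rewrite -[Vstar w](subrK (lower_value K AA (density_payoff g (rho l)) w)).
  rewrite addrC (le_trans (ler_normD _ _))// lerD//; last by rewrite distrC ltW.
  apply: lower_value_norm_le => // z Kz.
  have prho := rho_pd l l0; have irho := integrable_probability_density prho.
  apply: le_trans (density_payoff_le g1 gmeas irho Kz) _.
  rewrite [leLHS](_ : _ = 1)// -[RHS]/(fine 1%:E).
  rewrite -(integral_probability_density prho); congr fine.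
  apply: eq_integral => t; rewrite inE/= in_itv/= andbT => t0.
  by rewrite ger0_norm//; case: prho => _ ->.
have cvg := uniform_density_values_cvg g1 gmeas Vs1 AA0 AAp AAc AAw
  BB0 BBp BBc BBw rho_pd rho_self_similar rho0 rho_flat nu0 saddle
  lower_cvg upper_cvg.
have le m w : 0 < m -> lower_value K AA (density_payoff g (uniform_density m)) w <=
    upper_value K BB (density_payoff g (uniform_density m)) w.
  move=> m0; apply: lower_le_upper => //.
  exact: (density_payoff_bounded g1 gmeas (uniform_density_integrable m0)).
pose L m := lower_value K AA (density_payoff g (uniform_density m)).
pose U m := upper_value K BB (density_payoff g (uniform_density m)).
have sandwich e : 0 < e -> \forall m \near 0^'+, forall w,
    [/\ Vstar w - e / 3 <= L m w, L m w <= U m w & U m w <= Vstar w + e / 3].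
  move=> e0; have e30 : 0 < e / 3 by rewrite divr_gt0.
  near=> m => w; have m0 : 0 < m by [].
  have [? ?] : U m w <= Vstar w + e / 3 /\ Vstar w - e / 3 <= L m w.
    by move: w; near: m; exact: cvg.
  by split => //; exact: le.
split=> e e0; apply: filterS (sandwich e e0) => m H w; have [H1 H2 H3] := H w.
- by rewrite subr0 normr_id distrC ger0_norm ?subr_ge0 // -/(L m) -/(U m); lra.
- by rewrite ltr_norml -/(L m); apply/andP; split; lra.
- by rewrite ltr_norml -/(U m); apply/andP; split; lra.
Unshelve. all: by end_near. Qed.
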